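(* Let $E$ be one of the spaces $C_0^1([0,1],\mathbb{R}^d)$, $W^{1,1}_0([0,1],\mathbb{R}^d)$, $W^{1,2}_0([0,1],\mathbb{R}^d)$, with $E_1$ the corresponding space of scalar functions. Let $\{e_n\}_{n\ge1}$ be a weakly uniformly dense orthonormal basis in $L_2(0,1)$ consisting of functions from $E_1$ with $e_n(1)=0$ for all $n\in\mathbb{N}$, and suppose that the sequence $\{e_n\}$ is uniformly bounded. If $f\in \mathrm{dom}\,\Delta_L$, then $\Delta^{\{e_n\}}_Lf=\Delta_Lf$ and $\Box^{\{e_n\}}_Lf=\Box_Lf$. If $g\in\{\delta,\eta\}$ and $B\in \mathrm{dom}\,div^g_L$, then $div^{\{e_n\},g}_LB=div^g_LB$.
   Context: Spaces. $W^{1,p}_0([0,1],\mathbb{R}^d)$ is the space of absolutely continuous $\sigma:[0,1]\to\mathbb{R}^d$ with $\sigma(0)=0$ and $\dot\sigma\in L_p((0,1),\mathbb{R}^d)$; $C_0^1([0,1],\mathbb{R}^d)=\{\sigma\in C^1([0,1],\mathbb{R}^d):\sigma(0)=0\}$ (usual norms). No condition is imposed at $t=1$. $E_1$ is the same space with $\mathbb{R}^d$ replaced by $\mathbb{R}$, so that $E=\mathbb{R}^d\otimes E_1$, continuously and densely embedded in $\mathbb{R}^d\otimes L_2(0,1)$. $E_0=\{\sigma\in E:\sigma(1)=0\}$. For $p\in\mathbb{R}^d$, $e\in E_1$, $p\otimes e\in E$ is the function $t\mapsto e(t)p$. Metrics. $\{p_1,\dots,p_d\}$ is an orthonormal basis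 of $\mathbb{R}^d$; in it $\delta=\mathrm{diag}(1,\dots,1)$ and $\eta=\mathrm{diag}(1,-1,\dots,-1)$; $g\in\{\delta,\eta\}$, $g^{\mu\nu}$ is the inverse matrix. Repeated upper and lower indices are summed. Continuous bilinear functionals on $E\times E$ are identified with elements of $L(E,E^\ast)$ by $Q(u,v)=\langle Qu,v\rangle$. Lévy trace generated by a basis. For $T\in L(E,E^\ast)$, $$tr^{\{e_n\},g}_L(T)=\lim_{n\to\infty}\frac1n\sum_{k=1}^n\Big(\langle T(p_1\otimes e_k),p_1\otimes e_k\rangle+\epsilon_g\sum_{\mu=2}^d\langle T(p_\mu\otimes e_k),p_\mu\otimes e_k\rangle\Big),\quad \epsilon_\delta=1,\ \epsilon_\eta=-1,$$ with domain the set of $T$ for which the limit exists. Lévy trace as an integral functional. $T^2_E$ is the space of continuous bilinear functionals $Q$ on $E\times E$ whose restriction to $E_0\times E_0$ has the form $$Q(u,v)=\int_0^1\!\!\int_0^1 Q^V_{\mu\nu}(t,s)u^\mu(t)v^\nu(s)\,dt\,ds+\int_0^1Q^L_{\mu\nu}(t)u^\mu(t)v^\nu(t)\,dt+\frac12\int_0^1Q^S_{\mu\nu}(t)\big(\dot u^\mu(t)v^\nu(t)+\dot v^\mu(t)u^\nu(t)\big)dt,$$ with $Q^V_{\mu\nu}\in L_1([0,1]^2,\mathbb{R})$, $Q^L_{\mu\nu}\in L_1([0,1],\mathbb{R})$, $Q^S_{\mu\nu}\in L_\infty([0,1],\mathbb{R})$, $Q^L_{\mu\nu}=Q^L_{\nu\mu}$,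 $Q^S_{\mu\nu}=-Q^S_{\nu\mu}$. On $T^2_E$ one sets $tr^g_LQ=\int_0^1Q^L_{\mu\nu}(t)g^{\mu\nu}\,dt$. Differential operators. $C^n(X,Y)$ is the space of $n$ times Fréchet differentiable functions from $X$ to $Y$. If $S$ is a linear functional with domain $\mathrm{dom}\,S\subset L(E,E^\ast)$, then $D^{2,S}f(x)=S(f''(x))$ with domain the set of $f\in C^2(E,\mathbb{R})$ such that $f''(x)\in\mathrm{dom}\,S$ for all $x\in E$, and $D^{1,S}B(x)=S(B'(x))$ with domain the set of $B\in C^1(E,E^\ast)$ such that $B'(x)\in\mathrm{dom}\,S$ for all $x\in E$. Then: $\Delta^{\{e_n\}}_L=D^{2,tr^{\{e_n\},\delta}_L}$, $\Box^{\{e_n\}}_L=D^{2,tr^{\{e_n\},\eta}_L}$, $div^{\{e_n\},g}_L=D^{1,tr^{\{e_n\},g}_L}$ (generated by the basis), and $\Delta_L=D^{2,tr^\delta_L}$, $\Box_L=D^{2,tr^\eta_L}$, $div^g_L=D^{1,tr^g_L}$ (generated by the integral traces, with $\mathrm{dom}\,tr^g_L=T^2_E$). An orthonormal basis $\{e_n\}$ of $L_2(0,1)$ is weakly uniformly dense if for every $h\in L_\infty[0,1]$, $\lim_{n\to\infty}\int_0^1h(t)\big(\frac1n\sum_{k=1}^ne_k^2(t)-1\big)dt=0$. Uniformly bounded means $\sup_n\sup_{t\in[0,1]}|e_n(t)|<\infty$. *)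

(* Defs.v *)
From HB Require Import structures.
From mathcomp Require Import all_boot all_order all_algebra.
From mathcomp Require Import all_classical all_reals all_analysis.
From mathcomp Require Import lra measurable_realfun ess_sup_inf.
Import Order.TTheory GRing.Theory Num.Theory.
Import numFieldNormedType.Exports.
Set Implicit Arguments.
Unset Strict Implicit.
Unset Printing Implicit Defensive.
Local Open Scope classical_set_scope.
Local Open Scope ring_scope.

Section ContinuousLinear.
Context {R : realType} (V W : normedModType R).

Definition continuous_linear : {pred V -> W} :=
  mem [set f : V -> W | linear f /\ continuous f].
Definition continuous_linear_key : pred_key continuous_linear. Proof. by []. Qed.
Canonical continuous_linear_keyed := KeyedPred continuous_linear_key.

Lemma continuous_linear_submod : submod_closed continuous_linear.
Proof.
split.
  rewrite inE; split; first by move=> a x y; rewrite /= scaler0 addr0.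
  exact: cst_continuous.
move=> a f g; rewrite !inE => -[lf cf] [lg cg]; split.
  move=> b x y; rewrite !fctE lf lg !scalerDr !scalerA (mulrC a b).
  by rewrite addrACA.
by move=> x; apply: cvgD; [apply: cvgZr; exact: cf|exact: cg].
Qed.

HB.instance Definition _ :=
  GRing.isSubmodClosed.Build _ _ continuous_linear continuous_linear_submod.

(* The space L(V, W) of continuous linear maps with the operator norm; the dual
   space V^* is [clin V R^o], and a continuous bilinear functional on V x V is an
   element of [clin V (clin V R^o)], applied as [Q u v]. *)
Record clin := Clin {
  clin_fun :> V -> W;
  _ : clin_fun \in continuous_linear }.

HB.instance Definition _ := [isSub for clin_fun].
HB.instance Definition _ := [Choice of clin by <:].
HB.instance Definition _ := [SubChoice_isSubLmodule of clin by <:].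

Lemma clinP (f : clin) : linear f /\ continuous f.
Proof. by case: f => f /=; rewrite inE. Qed.

HB.instance Definition _ (f : clin) :=
  GRing.isLinear.Build R V W _ (clin_fun f) (clinP f).1.

Definition opnorm (f : clin) : R := sup [set `|f x| | x in [set x : V | `|x| <= 1]].

Let opnorm_set_neq0 (f : clin) : [set `|f x| | x in [set x : V | `|x| <= 1]] !=set0.
Proof. by exists `|f 0|, 0 => //=; rewrite normr0. Qed.

Let opnorm_bounded (f : clin) :
  has_ubound [set `|f x| | x in [set x : V | `|x| <= 1]].
Proof.
have [lf cf] := clinP f.
have /linear_boundedP : bounded_near (f : {linear V -> W}) (nbhs 0).
  by apply/linear_bounded_continuous.
move=> /pinfty_ex_gt0 [r r0 fr]; exists r => _ [x /= x1 <-].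
by rewrite (le_trans (fr x))// ler_piMr// ltW.
Qed.

Lemma opnorm_ge (f : clin) x : `|x| <= 1 -> `|f x| <= opnorm f.
Proof. by move=> x1; apply: ub_le_sup => //; exists x. Qed.

Lemma opnorm_le (f : clin) r : (forall x, `|x| <= 1 -> `|f x| <= r) -> opnorm f <= r.
Proof. by move=> fr; apply: ge_sup => // _ [x /= /fr ? <-]. Qed.

Lemma opnorm_ge0 (f : clin) : 0 <= opnorm f.
Proof. by rewrite (le_trans _ (@opnorm_ge f 0 _))// normr0. Qed.

Lemma ler_opnormD (f g : clin) : opnorm (f + g) <= opnorm f + opnorm g.
Proof.
apply: opnorm_le => x x1.
by rewrite (le_trans (ler_normD _ _))// lerD// opnorm_ge.
Qed.

Let opnormZ_le (a : R) (f : clin) : opnorm (a *: f) <= `|a| * opnorm f.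
Proof.
by apply: opnorm_le => x x1; rewrite normrZ ler_wpM2l// opnorm_ge.
Qed.

Lemma opnormZ (a : R) (f : clin) : opnorm (a *: f) = `|a| * opnorm f.
Proof.
apply/eqP; rewrite eq_le opnormZ_le/=.
have [->|a0] := eqVneq a 0; first by rewrite normr0 mul0r opnorm_ge0.
rewrite -{1}(scale1r f) -(mulVf a0) -scalerA.
by rewrite (le_trans (ler_wpM2l _ (opnormZ_le _ _)))// mulrA -normrM mulfV// normr1 mul1r.
Qed.

Lemma opnorm_eq0 (f : clin) : opnorm f = 0 -> f = 0.
Proof.
move=> f0; apply/val_inj/funext => x /=.
have [->|x0] := eqVneq x 0; first by rewrite linear0.
have nx0 : `|x| != 0 by rewrite normr_eq0.
rewrite -(scale1r x) -(mulfV nx0) -scalerA linearZ/=.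
suff -> : f (`|x|^-1 *: x) = 0 by rewrite scaler0.
apply/normr0_eq0/eqP; rewrite -normr_le0 normr_id -f0 opnorm_ge//.
by rewrite normrZ normfV normr_id mulVf.
Qed.

HB.instance Definition _ :=
  Lmodule_isNormed.Build R clin ler_opnormD opnormZ opnorm_eq0.

End ContinuousLinear.
Section UnitInterval.
Context (R : realType).

(* Lebesgue measure on R restricted to [0, 1]; all integrals, null sets and L_p
   spaces below refer to it, so functions on [0, 1] are total functions on R. *)
Definition mu01 :=
  mrestr (@lebesgue_measure R) (measurable_itv `[0%R : R, 1%R]).

HB.instance Definition _ := Measure.on mu01.

Lemma mu01E (A : set R) : mu01 A = lebesgue_measure (A `&` `[0, 1]).
Proof. by []. Qed.

Lemma mu01T : mu01 [set: R] = 1%E.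
Proof. by rewrite mu01E setTI lebesgue_measure_itv/= lte_fin ltr01 sube0. Qed.

Let mu01_fin : fin_num_fun mu01.
Proof.
move=> A mA; rewrite ge0_fin_numE// (@le_lt_trans _ _ (mu01 setT))//.
  by apply: le_measure => //; rewrite inE.
by rewrite mu01T ltry.
Qed.

HB.instance Definition _ := Measure_isFinite.Build _ _ _ mu01 mu01_fin.

Global Instance ae_mu01_filter : Filter (nbhs (almost_everywhere mu01)).
Proof. exact: (@ae_filter_ringOfSetsType _ _ _ mu01). Qed.

Definition abs_continuous01 (f : R -> R) := forall eps : R, 0 < eps ->
  exists2 dlt : R, 0 < dlt & forall s : seq (R * R),
    all (fun I : R * R => [&& 0 <= I.1, I.1 <= I.2 & I.2 <= 1]) s ->
    pairwise (fun I J : R * R => (I.2 <= J.1) || (J.2 <= I.1)) s ->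
    \sum_(I <- s) (I.2 - I.1) < dlt ->
    \sum_(I <- s) `|f I.2 - f I.1| < eps.

(* The spaces C^1_0, W^{1,1}_0 and W^{1,2}_0. *)
Inductive path_kind := C1 | W11 | W12.

Definition path_exponent (k : path_kind) : \bar R :=
  match k with C1 => +oo%E | W11 => 1%E | W12 => 2%:E end.

Definition ae_derivative (f h : R -> R) : Prop :=
  {ae mu01, forall t : R, is_derive t (1 : R) f (h t)}.

(* Membership in E_1. A function on [0, 1] is represented by its extension by zero,
   which makes equality of representatives equality on [0, 1]. Asking for a
   derivative on ]0, 1[ with a continuous extension to [0, 1] is the same as asking
   for a continuous derivative on [0, 1] that is one-sided at 0 and 1. There is no
   condition at t = 1. *)
Definition E1_pred (k : path_kind) : {pred R -> R} :=
  mem [set f : R -> R | [/\ f 0 = 0, forall t : R, t \notin `[0, 1] -> f t = 0 &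
    match k with
    | C1 => {within `[0 : R, 1], continuous f} /\
        exists2 h : R -> R, {within `[0 : R, 1], continuous h} &
          forall t : R, t \in `]0, 1[ -> is_derive t (1 : R) f (h t)
    | W11 | W12 => abs_continuous01 f /\
        exists2 h, h \in Lfun mu01 (path_exponent k) & ae_derivative f h
    end]].
Definition E1_key k : pred_key (E1_pred k). Proof. by []. Qed.
Canonical E1_keyed k := KeyedPred (E1_key k).

Lemma path_exponent_ge1 k : (1 <= path_exponent k)%E.
Proof. by case: k => //=; rewrite ?leey// lee1n. Qed.

Lemma ae01 (P : R -> Prop) : (forall t : R, t \in `]0, 1[ -> P t) -> {ae mu01, forall t, P t}.
Proof.
move=> HP; exists (~` `]0, 1[); split.
- by apply: measurableC; exact: measurable_itv.
- rewrite mu01E.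
  apply/eqP; rewrite eq_le measure_ge0 andbT.
  rewrite (@le_trans _ _ (lebesgue_measure ([set 0] `|` [set 1 : R])))//; last first.
    have m1 (x : R) : lebesgue_measure [set x] = 0%E by exact: lebesgue_measure_set1.
    have mU := @measureU0 _ _ _ (@lebesgue_measure R) [set 0] [set 1].
    rewrite le_eqVlt; apply/orP; left; apply/eqP.
    exact: etrans (mU (measurable_set1 _) (measurable_set1 _) (m1 _)) (m1 _).
  apply: le_measure; rewrite ?inE.
  + by apply: measurableI; [apply: measurableC|]; exact: measurable_itv.
  + by apply: measurableU; exact: measurable_set1.
  move=> t /=; rewrite !in_itv/=.
    move=> [/negP]; rewrite negb_and -!leNgt => /orP[t0|t1] /andP[t0' t1'].
      by left; apply/eqP; rewrite eq_le t0.
    by right; apply/eqP; rewrite eq_le t1 t1'.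

- by move=> t /= nP; rewrite /setC/= => t01; apply: nP; exact: HP.
Qed.

Lemma abs_continuousD a f g : abs_continuous01 f -> abs_continuous01 g ->
  abs_continuous01 (fun t => a * f t + g t).
Proof.
move=> cf cg e e0.
have a0 : 0 < `|a| + 1 by rewrite ltr_wpDl.
have [d1 d10 h1] := cf (e / 2 / (`|a| + 1)) (divr_gt0 (divr_gt0 e0 (ltr0n _ 2)) a0).
have [d2 d20 h2] := cg (e / 2) (divr_gt0 e0 (ltr0n _ 2)).
exists (Num.min d1 d2); first by rewrite lt_min d10.
move=> s s1 s2; rewrite lt_min => /andP[sd1 sd2].
rewrite (splitr e).
apply: (@le_lt_trans _ _ ((`|a| + 1) * (\sum_(I <- s) `|f I.2 - f I.1|) +
    \sum_(I <- s) `|g I.2 - g I.1|)).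
  rewrite mulr_sumr -big_split/=; apply: ler_sum => I _.
  rewrite (_ : _ - _ = a * (f I.2 - f I.1) + (g I.2 - g I.1)); last first.
    by rewrite mulrBr opprD addrACA.
  rewrite (le_trans (ler_normD _ _))// lerD2r normrM ler_wpM2r//.
  by rewrite lerDl.
by rewrite ltrD ?h2// mulrC -ltr_pdivlMr// h1.
Qed.

Lemma abs_continuous_within f : abs_continuous01 f ->
  {within `[0 : R, 1], continuous f}.
Proof.
move=> cf; apply/subspace_continuousP => x /=; rewrite in_itv/= => /andP[x0 x1].
apply/cvgrPdist_lt => e e0.
have [d d0 h] := cf e e0.
near=> y.
have : y \in `[0, 1] by near: y; apply: withinT; exact: filter_nbhsP.
rewrite in_itv/= => /andP[y0 y1].
have xyd : `|x - y| < d.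
  near: y; apply: cvg_within; apply: (@cvgr_dist_lt _ _ _ (nbhs x) _ id) => //.
have [xy|yx] := leP x y.
  rewrite distrC.
  have := h [:: (x, y)]; rewrite /= !big_seq1/=; apply => //.
    by rewrite x0 xy y1.
  by rewrite -(ger0_norm (_ : 0 <= y - x)) ?subr_ge0// distrC.
have := h [:: (y, x)]; rewrite /= !big_seq1/=; apply => //.
  by rewrite y0 (ltW yx) x1.
by rewrite -(ger0_norm (_ : 0 <= x - y)) ?subr_ge0// ltW.
Unshelve. all: by end_near. Qed.

Lemma E1_continuous k f : f \in E1_pred k -> {within `[0 : R, 1], continuous f}.
Proof.
by rewrite inE => -[_ _]; case: k => -[+ _] //; exact: abs_continuous_within.
Qed.

Lemma continuous01_Lfun p f : (1 <= p)%E ->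
  {within `[0 : R, 1], continuous f} -> f \_ `[0 : R, 1] \in Lfun mu01 p.
Proof.
move=> p1 cf.
apply: (@Lfun_subset _ _ _ mu01 p +oo%E) => //.
- by rewrite leey.
- by apply: fin_num_measure; exact: measurableT.
- by rewrite leey.
have mf : measurable_fun setT (f \_ `[0 : R, 1]).
  apply/(measurable_restrictT f (measurable_itv `[0 : R, 1])).
  apply: subspace_continuous_measurable_fun; last exact: cf.
  exact: measurable_itv.
have [M [Mr fM]] : bounded_set (f @` `[0 : R, 1]).
  by apply: compact_bounded; apply: continuous_compact => //; exact: segment_compact.
rewrite inE; apply/andP; split; rewrite inE//=.
rewrite /finite_norm unlock /Lnorm; case: ifPn => // _.
apply: (@le_lt_trans _ _ (`|M| + 1)%:E); last by rewrite ltry.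
apply/ess_supP; apply: nearW => t /=.
rewrite lee_fin /patch; case: ifPn => [t01|_]; last by rewrite normr0 addr_ge0.
apply: (fM (`|M| + 1)).
  by rewrite (le_lt_trans (ler_norm _))// ltrDl.
by exists t => //; rewrite inE in t01.
Qed.

Lemma E1_Lfun k f : f \in E1_pred k -> f \in Lfun mu01 (path_exponent k).
Proof.
move=> fE; have := continuous01_Lfun (path_exponent_ge1 k) (E1_continuous fE).
suff -> : f \_ `[0 : R, 1] = f by [].
move: fE; rewrite inE => -[_ f0 _]; apply/funext => t; rewrite /patch.
case: ifPn => // t01; rewrite f0//.
by apply: contra t01 => ?; rewrite inE.
Qed.

Lemma E1_derivative k f : f \in E1_pred k ->
  exists2 h, h \in Lfun mu01 (path_exponent k) & ae_derivative f h.
Proof.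
rewrite inE => -[_ _]; case: k => -[_]//= [h ch fh].
exists (h \_ `[0 : R, 1]); first exact: continuous01_Lfun (path_exponent_ge1 C1) ch.
apply: ae01 => t t01; rewrite /patch mem_set; first exact: fh.
by apply: subset_itv_oo_cc.
Qed.

Lemma ae_derivative_lin a f g h l : ae_derivative f h -> ae_derivative g l ->
  ae_derivative (a *: f + g) (a *: h + l).
Proof. by apply: filterS2 => t dh dl; exact: is_deriveD. Qed.

Lemma ae_derivative_unique f h l : ae_derivative f h -> ae_derivative f l ->
  {ae mu01, forall t, h t = l t}.
Proof.
apply: filterS2 => t dh dl.
by rewrite -(@derive_val _ _ _ _ _ _ _ dh) (@derive_val _ _ _ _ _ _ _ dl).
Qed.

Lemma E1_submod k : submod_closed (E1_pred k).
Proof.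
split.
  rewrite inE; split => //; case: k => /=.
  - split; first by move=> ?; exact: cst_continuous.
    exists (cst 0); first by move=> ?; exact: cst_continuous.
    by move=> t _; exact: is_derive_cst.
  - split.
      move=> e e0; exists 1 => // s _ _ _; rewrite big1// => I _.
      by rewrite /= subrr normr0.
    exists 0; last by apply: nearW => t; exact: is_derive_cst.
    by have [] := @Lfun_submod_closed _ _ _ mu01 _ (path_exponent_ge1 W11).
  - split.
      move=> e e0; exists 1 => // s _ _ _; rewrite big1// => I _.
      by rewrite /= subrr normr0.
    exists 0; last by apply: nearW => t; exact: is_derive_cst.
    by have [] := @Lfun_submod_closed _ _ _ mu01 _ (path_exponent_ge1 W12).
move=> a f g fE gE.
have [cf cg] := (E1_continuous fE, E1_continuous gE).
have [hf hfL df] := E1_derivative fE.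
have [hg hgL dg] := E1_derivative gE.
have hL : a *: hf + hg \in Lfun mu01 (path_exponent k).
  by have [_] := @Lfun_submod_closed _ _ _ mu01 _ (path_exponent_ge1 k); apply.
have dh := ae_derivative_lin a df dg.
move: fE gE; rewrite !inE => -[f0 fo fk] [g0 go gk]; split.
- by rewrite !fctE f0 g0 scaler0 addr0.
- by move=> t t01; rewrite !fctE fo// go// scaler0 addr0.
case: k fk gk hfL hgL hL => /=.
- move=> [_ [h1 ch1 dh1]] [_ [h2 ch2 dh2]] _ _ _; split.
    by move=> x; apply: cvgD; [apply: cvgZl_tmp; exact: cf|exact: cg].
  exists (a *: h1 + h2).
    by move=> x; apply: cvgD; [apply: cvgZl_tmp; exact: ch1|exact: ch2].
  by move=> t t01; apply: is_deriveD; [apply: is_deriveZ; exact: dh1|exact: dh2].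
- move=> [af _] [ag _] _ _ hL; split; first exact: abs_continuousD.
  by exists (a *: hf + hg).
- move=> [af _] [ag _] _ _ hL; split; first exact: abs_continuousD.
  by exists (a *: hf + hg).
Qed.

HB.instance Definition _ k :=
  GRing.isSubmodClosed.Build _ _ (E1_pred k) (@E1_submod k).

(* A Borel version of the a.e. derivative; it is determined up to null sets. *)
Definition dot (f : R -> R) : R -> R :=
  xget 0 [set h | measurable_fun setT h /\ ae_derivative f h].


Lemma eq_ae_Lnorm p (f g : R -> R) : measurable_fun setT f -> measurable_fun setT g ->
  {ae mu01, forall t, f t = g t} ->
  'N[mu01]_p[EFin \o f]%E = 'N[mu01]_p[EFin \o g]%E.
Proof.
move=> mf mg fg; rewrite unlock /Lnorm; case: p => [p| |].
- congr (poweR _ _); apply: ge0_ae_eq_integral => //.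
  + apply/measurable_EFinP; apply: (@measurableT_comp _ _ _ _ _ _ (@powR R ^~ p)) => //.
    exact: measurableT_comp.
  + apply/measurable_EFinP; apply: (@measurableT_comp _ _ _ _ _ _ (@powR R ^~ p)) => //.
    exact: measurableT_comp.
  + by move=> t _; rewrite poweR_ge0.
  + by move=> t _; rewrite poweR_ge0.
  + by apply: filterS fg => t /= -> _.
- by case: ifPn => // _; apply: eq_ess_sup; apply: filterS fg => t /= ->.
- by case: ifPn => // _; apply: eq_ess_inf; apply: filterS fg => t /= ->.
Qed.

Lemma Lfun_measurable p f : f \in Lfun mu01 p -> measurable_fun setT f.
Proof. by rewrite inE => /andP[/[1!inE]]. Qed.

Lemma dotP f h : measurable_fun setT h -> ae_derivative f h ->
  measurable_fun setT (dot f) /\ ae_derivative f (dot f).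
Proof.
move=> mh fh; pose P := [set l | measurable_fun setT l /\ ae_derivative f l].
exact: (@xgetPex _ 0 P (ex_intro _ h (conj mh fh))).
Qed.

Lemma E1_dot k f : f \in E1_pred k ->
  ae_derivative f (dot f) /\ dot f \in Lfun mu01 (path_exponent k).
Proof.
move=> /E1_derivative[h hL fh].
have mh := Lfun_measurable hL.
have [md fd] := dotP mh fh; split => //.
move: hL; rewrite !inE => /andP[_ /[1!inE] hfin].
apply/andP; split; rewrite inE//= /finite_norm.
rewrite (@eq_ae_Lnorm _ _ h)//; exact: ae_derivative_unique fd fh.
Qed.

(* ||f||_p + ||f'||_p, which for p = +oo and f in C^1 is sup |f| + sup |f'|. *)
Definition e1_norm k (f : R -> R) : R :=
  fine ('N[mu01]_(path_exponent k)[EFin \o f])%E +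
  fine ('N[mu01]_(path_exponent k)[EFin \o dot f])%E.

Let nm k (f : R -> R) := fine ('N[mu01]_(path_exponent k)[EFin \o f])%E.

Let nm_ge0 k f : 0 <= nm k f.
Proof. by rewrite fine_ge0// Lnorm_ge0. Qed.

Let nmD k f g : f \in Lfun mu01 (path_exponent k) ->
  g \in Lfun mu01 (path_exponent k) -> nm k (f + g) <= nm k f + nm k g.
Proof.
move=> fL gL.
exact: (ler_LnormD (Lfun_Sub (path_exponent_ge1 k) fL) (Lfun_Sub (path_exponent_ge1 k) gL)).
Qed.

Let nmZ k a f : f \in Lfun mu01 (path_exponent k) -> nm k (a *: f) = `|a| * nm k f.
Proof.
move=> fL.
rewrite /nm.
have := LnormZ (Lfun_Sub (path_exponent_ge1 k) fL) a => /= H.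
rewrite (_ : EFin \o (a *: f) = EFin \o (a \*: f))// H fineM//.
by have := finite_norm_fine (Lfun_Sub (path_exponent_ge1 k) fL) => /= <-.
Qed.

Let dot_ae k f h : f \in E1_pred k -> h \in Lfun mu01 (path_exponent k) ->
  ae_derivative f h -> nm k (dot f) = nm k h.
Proof.
move=> fE hL fh; have [fd dL] := E1_dot fE.
congr fine; apply: eq_ae_Lnorm.
- exact: Lfun_measurable dL.
- exact: Lfun_measurable hL.
- exact: ae_derivative_unique fd fh.
Qed.

Lemma e1_normD k f g : f \in E1_pred k -> g \in E1_pred k ->
  e1_norm k (f + g) <= e1_norm k f + e1_norm k g.
Proof.
move=> fE gE; have [[fd fL] [gd gL]] := (E1_dot fE, E1_dot gE).
rewrite /e1_norm addrACA lerD//; first by apply: nmD; exact: E1_Lfun.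
rewrite -[X in X <= _]/(nm k _) (@dot_ae _ _ (dot f + dot g)) ?nmD//.
- exact: rpredD.
- by rewrite -(scale1r (dot f)); have [_] := @Lfun_submod_closed _ _ _ mu01 _ (path_exponent_ge1 k); apply.
- by have := ae_derivative_lin 1 fd gd; rewrite !scale1r.
Qed.

Lemma e1_normZ k a f : f \in E1_pred k -> e1_norm k (a *: f) = `|a| * e1_norm k f.
Proof.
move=> fE; have [fd fL] := E1_dot fE.
have [L0 LD] := @Lfun_submod_closed _ _ _ mu01 _ (path_exponent_ge1 k).
rewrite /e1_norm mulrDr; congr (_ + _); first by apply: nmZ; exact: E1_Lfun.
rewrite -[LHS]/(nm k _) (@dot_ae _ _ (a *: dot f)) ?nmZ//.
- exact: rpredZ.
- by rewrite -(addr0 (a *: _)) LD.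
- by apply: filterS fd => t dt; exact: is_deriveZ.
Qed.

Lemma e1_norm_ge0 k f : 0 <= e1_norm k f.
Proof. by rewrite addr_ge0 ?nm_ge0. Qed.

Lemma e1_norm_eq0 k f : f \in E1_pred k -> e1_norm k f = 0 -> f = 0.
Proof.
move=> fE /eqP; rewrite paddr_eq0 ?nm_ge0// => /andP[/eqP nf0 _].
have fL := E1_Lfun fE.
have [N [mN N0 fN]] := fine_Lnormr_eq0 (f := Lfun_Sub (path_exponent_ge1 k) fL) nf0.
have cf := E1_continuous fE.
have f01 t : 0 <= t <= 1 -> f t = 0.
  move=> t01; apply/eqP; apply: contrapT => /negP ft0.
  have ft0' : 0 < `|f t| by rewrite normr_gt0.
  move/subspace_continuousP : cf => /(_ t); rewrite /= in_itv/= => /(_ t01).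
  move=> /cvgrPdist_lt /(_ _ ft0') /nbhs_ballP[e /= e0 te].
  pose a := Num.max 0 (t - e / 2); pose b := Num.min 1 (t + e / 2).
  have ab : a < b.
    rewrite /a /b lt_min !gt_max; move: t01 => /andP[t0 t1].
    by apply/andP; split; apply/andP; split; lra.
  have abN : `[a, b] `<=` N `&` `[0, 1].
    move=> s /=; rewrite in_itv/= /a /b le_min ge_max => /andP[/andP[s0 ts] /andP[s1 st]].
    split; last by rewrite in_itv/= s0.
    apply: fN => /= fs; have fs0 : f s = 0 by exact: fs.
    have : `|f t - f s| < `|f t|.
      apply: te => /=; last by rewrite in_itv/= s0.
      by rewrite /ball/= ltr_distlC; lra.
    by rewrite fs0 subr0 ltxx.
  have : (lebesgue_measure `[a, b] <= mu01 N)%E.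
    rewrite mu01E; apply: le_measure => //; rewrite inE; first exact: measurable_itv.
    by apply: measurableI => //; exact: measurable_itv.
  by rewrite N0 lebesgue_measure_itv/= lte_fin ab -EFinB lee_fin leNgt subr_gt0 ab.
move: fE; rewrite inE => -[_ fo _]; apply/funext => t.
have [t01|t01] := boolP (t \in `[0, 1]); last exact: fo.
by apply: f01; rewrite in_itv/= in t01.
Qed.

End UnitInterval.

Section PathSpace.
Context (R : realType) (k : path_kind) (n : nat).

(* E is R^n (x) E_1: a path belongs to E when its components belong to E_1. *)
Definition path_pred : {pred R -> 'rV[R]_n} :=
  mem [set u : R -> 'rV[R]_n | forall i, (fun t => u t 0 i) \in E1_pred k].
Definition path_key : pred_key path_pred. Proof. by []. Qed.
Canonical path_keyed := KeyedPred path_key.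

Lemma path_submod : submod_closed path_pred.
Proof.
split.
  rewrite inE => i; rewrite (_ : (fun _ => _) = 0) ?rpred0//.
  by apply/funext => t; rewrite mxE.
move=> a u v; rewrite !inE => uE vE i.
rewrite (_ : (fun _ => _) = a *: (fun t => u t 0 i) + (fun t => v t 0 i)).
  by rewrite rpredD// rpredZ.
by apply/funext => t; rewrite /= !fctE !mxE.
Qed.

HB.instance Definition _ :=
  GRing.isSubmodClosed.Build _ _ path_pred path_submod.

Record Espace := EPath {
  path_fun :> R -> 'rV[R]_n;
  _ : path_fun \in path_pred }.

HB.instance Definition _ := [isSub for path_fun].
HB.instance Definition _ := [Choice of Espace by <:].
HB.instance Definition _ := [SubChoice_isSubLmodule of Espace by <:].

Lemma EspaceP (u : Espace) i : (fun t => u t 0 i) \in E1_pred k.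
Proof. by case: u => u /=; rewrite inE. Qed.

(* The sum over components is equivalent to the norm built on the Euclidean norm of
   R^n, so it gives the same topology and the same Frechet derivatives. *)
Definition path_norm (u : Espace) : R := \sum_i e1_norm k (fun t => u t 0 i).

Lemma path_normD u v : path_norm (u + v) <= path_norm u + path_norm v.
Proof.
rewrite -big_split/=; apply: ler_sum => i _.
rewrite (_ : (fun _ => _) = (fun t => u t 0 i) + (fun t => v t 0 i)).
  by apply: e1_normD; exact: EspaceP.
by apply/funext => t; rewrite fctE /= mxE.
Qed.

Lemma path_normZ a u : path_norm (a *: u) = `|a| * path_norm u.
Proof.
rewrite mulr_sumr; apply: eq_bigr => i _; rewrite -e1_normZ; last exact: EspaceP.
by congr e1_norm; apply/funext => t; rewrite fctE /= mxE.
Qed.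

Lemma path_norm_eq0 u : path_norm u = 0 -> u = 0.
Proof.
move=> /eqP; rewrite psumr_eq0; last by move=> *; exact: e1_norm_ge0.
move=> /allP u0; apply/val_inj/funext => t /=; apply/rowP => i; rewrite !mxE.
have /(_ i) := u0; rewrite mem_index_enum => /(_ isT) /eqP.
by move=> /(e1_norm_eq0 (EspaceP u i)) /(congr1 (fun f => f t)).
Qed.

HB.instance Definition _ :=
  Lmodule_isNormed.Build R Espace path_normD path_normZ path_norm_eq0.

Record E1space := E1Path {
  e1_fun :> R -> R;
  e1P : e1_fun \in E1_pred k }.

Lemma tens_subproof (p : 'rV[R]_n) (e : E1space) :
  (fun t => e t *: p) \in path_pred.
Proof.
rewrite inE => i; rewrite (_ : (fun _ => _) = p 0 i *: e1_fun e).
  by rewrite rpredZ// e1P.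
by apply/funext => t; rewrite fctE !mxE mulrC.
Qed.

Definition tens p e : Espace := EPath (tens_subproof p e).

End PathSpace.

(* The metrics delta and eta. *)
Inductive metric := Euclidean | Lorentzian.

Section Metric.
Context (R : realType) (d : nat).

(* epsilon_g *)
Definition metric_sign (g : metric) : R :=
  match g with Euclidean => 1 | Lorentzian => -1 end.

Definition metric_mx (g : metric) : 'M[R]_d.+1 :=
  diag_mx (\row_i if i == 0 then 1 else metric_sign g).

End Metric.

(* The target R^d has d >= 1, and it is written R^(d.+1). Its orthonormal basis
   p_1, ..., p_d consists of the rows of P.

   A partial function from X to Y is represented by A : X -> set Y: A x contains the
   values of A at x, and it is empty when x is outside the domain. Traces are partial
   functions from L(E, E^* ) to R, and differential operators are partial functions
   from the functions on E to the functions E -> R. *)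
Definition dom (X Y : Type) (A : X -> set Y) : set X := [set x | A x !=set0].

(* A x and B x are both defined, and they are the same single value. *)
Definition same_value (X Y : Type) (A B : X -> set Y) (x : X) : Prop :=
  exists y, A x = [set y] /\ B x = [set y].

Section LevyTraces.
Context (R : realType) (k : path_kind) (d : nat).
Local Notation E := (Espace R k d.+1).
Local Notation dualE := (clin E R^o).
Local Notation bilE := (clin E dualE).
Local Notation mu := (@mu01 R).
Context (P : 'M[R]_d.+1).

(* u^mu, the coordinate of u along the row mu of the orthogonal matrix P *)
Definition coordinate (u : E) (m : 'I_d.+1) : R -> R :=
  fun t => (u t *m P^T) 0 m.

(* The sequences are indexed from 0: [e j] is e_{j+1}. *)
Definition basis_levy_trace (e : nat -> E1space R k) (g : metric)
    (T : bilE) : set R :=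
  let q m j := T (tens (row m P) (e j)) (tens (row m P) (e j)) in
  [set tau : R | (fun n : nat => n%:R^-1 * \sum_(j < n)
      (q ord0 j + metric_sign R g * \sum_(m < d.+1 | m != ord0) q m j))
    @ \oo --> tau].

(* The form of Q on E_0 x E_0; z = (t, s) in the first integral. *)
Definition integral_form (Q : bilE)
    (QV : 'I_d.+1 -> 'I_d.+1 -> R * R -> R) (QL QS : 'I_d.+1 -> 'I_d.+1 -> R -> R) :=
  [/\ forall m n, QV m n \in Lfun (mu \x mu)%E 1,
      forall m n, QL m n \in Lfun mu 1 /\
        {ae mu, forall t, QL m n t = QL n m t},
      forall m n, QS m n \in Lfun mu +oo /\
        {ae mu, forall t, QS m n t = - QS n m t} &
      forall u v : E, u 1 = 0 -> v 1 = 0 ->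
        let u_ := coordinate u in let v_ := coordinate v in
        Q u v =
          \int[(mu \x mu)%E]_z
             (\sum_m \sum_n QV m n z * u_ m z.1 * v_ n z.2)
        + \int[mu]_t (\sum_m \sum_n QL m n t * u_ m t * v_ n t)
        + 2^-1 * \int[mu]_t (\sum_m \sum_n QS m n t *
             (dot (u_ m) t * v_ n t + dot (v_ m) t * u_ n t))].

(* tr^g_L with domain T^2_E. The value is taken for every choice of the kernels. *)
Definition integral_levy_trace (g : metric) (Q : bilE) : set R :=
  [set tau : R | exists QV QL QS, integral_form Q QV QL QS /\
    tau = \int[mu]_t (\sum_m \sum_n QL m n t * invmx (metric_mx R d g) m n)].

(* D^{2,S} and D^{1,S}. [f1] and [f2] are the first and second Frechet derivatives
   of f as maps into E^* and L(E, E^* ) with their operator norms. *)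
Definition D2 (S : bilE -> set R) (f : E -> R^o) : set (E -> R) :=
  [set F : E -> R | exists (f1 : E -> dualE) (f2 : E -> bilE),
    [/\ forall x, is_diff x f (f1 x), forall x, is_diff x f1 (f2 x) &
        forall x, S (f2 x) (F x)]].

Definition D1 (S : bilE -> set R) (B : E -> dualE) : set (E -> R) :=
  [set F : E -> R | exists B1 : E -> bilE,
    (forall x, is_diff x B (B1 x)) /\ forall x, S (B1 x) (F x)].

Definition levy_laplacian := D2 (integral_levy_trace Euclidean).
Definition levy_dalembertian := D2 (integral_levy_trace Lorentzian).
Definition levy_divergence g := D1 (integral_levy_trace g).

Definition basis_levy_laplacian e := D2 (basis_levy_trace e Euclidean).
Definition basis_levy_dalembertian e := D2 (basis_levy_trace e Lorentzian).
Definition basis_levy_divergence e g := D1 (basis_levy_trace e g).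

End LevyTraces.

Section Bases.
Context (R : realType).
Local Notation mu := (@mu01 R).

Definition orthonormal_rows n (P : 'M[R]_n) : Prop := P *m P^T = 1%:M.

Definition L2_orthonormal_basis (e : nat -> R -> R) : Prop :=
  [/\ forall n, e n \in Lfun mu 2%:E,
      forall m n, \int[mu]_t (e m t * e n t) = (m == n)%:R &
      forall h, h \in Lfun mu 2%:E ->
        (fun n => 'N[mu]_2%:E[EFin \o
           (h - \sum_(j < n) (\int[mu]_t (h t * e j t)) *: e j)%R]%E)
          @ \oo --> 0%E].

Definition weakly_uniformly_dense (e : nat -> R -> R) : Prop :=
  forall h, h \in Lfun mu +oo ->
    (fun n : nat => \int[mu]_t
       (h t * (n%:R^-1 * \sum_(j < n) e j t ^+ 2 - 1))) @ \oo --> (0 : R).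

Definition uniformly_bounded (e : nat -> R -> R) : Prop :=
  exists M : R, forall n t, t \in `[0, 1] -> `|e n t| <= M.

End Bases.

(* Main.v *)
Require Import Defs.
From mathcomp Require Import all_boot all_order all_algebra.
From mathcomp Require Import all_classical all_reals all_analysis.
From mathcomp Require Import measurable_realfun ess_sup_inf lra.
Import Order.TTheory GRing.Theory Num.Theory.
Import numFieldNormedType.Exports.
Set Implicit Arguments.
Unset Strict Implicit.
Unset Printing Implicit Defensive.
Local Open Scope classical_set_scope.
Local Open Scope ring_scope.

(* On p_m (x) e_j the three terms of an integral form become the integral of
   QV_mm (e_j (x) e_j), the integral of QL_mm e_j^2, and 0, the last one because
   QS_mm = 0 a.e. by antisymmetry. In the Cesaro means over j, the first term tends
   to 0: the means of e_j (x) e_j have squared L^2 norm 1/n by orthonormality, and,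
   being uniformly bounded, they can be tested against L^1 kernels instead of bounded
   ones. The same approximation extends weak uniform density from L^oo to L^1, so the
   second term tends to the integral of QL_mm. Hence the basis trace exists on the
   domain of the integral trace and agrees with it there; in particular the integral
   trace does not depend on the choice of the kernels, and the differential operators
   inherit the equality because Frechet derivatives are unique. *)

(** * Integrability, truncation and weak convergence for real functions *)

Section RealIntegrals.
Context d (T : measurableType d) (R : realType) (mu : {measure set T -> \bar R}).

Lemma uniform_bounded_fun (h : T -> R) (D : set T) (C : R) :
  (forall x, `|h x| <= C) -> [bounded h x | x in D].
Proof.
by move=> hC; exists C; split => [|M /ltW CM x _]; [exact: num_real|exact: le_trans (hC x) CM].
Qed.

Lemma integrable_bounded (h : T -> R) (C : R) : (mu setT < +oo)%E ->
  measurable_fun setT h -> (forall x, `|h x| <= C) ->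
  mu.-integrable setT (EFin \o h).
Proof.
move=> muT mh hC; apply: measurable_bounded_integrable => //.
exact: uniform_bounded_fun hC.
Qed.

Lemma integrable_mul_bounded (f h : T -> R) (C : R) :
  mu.-integrable setT (EFin \o f) ->
  measurable_fun setT h -> (forall x, `|h x| <= C) ->
  mu.-integrable setT (EFin \o (fun x => f x * h x)).
Proof.
move=> fi mh hC.
by apply: (integrableMl measurableT fi mh); exact: uniform_bounded_fun hC.
Qed.

Lemma integrable_big (I : Type) (s : seq I) (h : I -> T -> R) :
  (forall i, mu.-integrable setT (EFin \o h i)) ->
  mu.-integrable setT (EFin \o (fun x => \sum_(i <- s) h i x)).
Proof.
move=> hi.
rewrite (_ : _ \o _ = fun x => \sum_(i <- s) (EFin \o h i) x)%E.
  exact: integrable_sum.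
by apply/funext => x /=; rewrite sumEFin.
Qed.

Lemma Rintegral_sum (I : Type) (s : seq I) (h : I -> T -> R) :
  (forall i, mu.-integrable setT (EFin \o h i)) ->
  \int[mu]_x (\sum_(i <- s) h i x) = \sum_(i <- s) \int[mu]_x h i x.
Proof.
move=> hi; elim: s => [|i s IH].
  by under eq_Rintegral do rewrite big_nil; rewrite big_nil Rintegral_cst// mul0r.
rewrite big_cons -IH -RintegralD//; last exact: integrable_big.
by under eq_Rintegral do rewrite big_cons.
Qed.

Lemma ae_eq0_Rintegral (f : T -> R) : measurable_fun setT f ->
  {ae mu, forall x, f x = 0} -> \int[mu]_x f x = 0.
Proof.
move=> mf f0; rewrite /Rintegral (ae_eq_integral (cst 0%E))//.
- by rewrite integral0.
- exact/measurable_EFinP.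
- by apply: filterS f0 => x -> _.
Qed.

(** Dominated convergence with majorant |f|: at a fixed point the error vanishes as soon as [N]
    reaches |f x|. *)
Lemma truncation_cvg_L1 (f : T -> R) : mu.-integrable setT (EFin \o f) ->
  (fun N : nat => \int[mu]_x `|f x - (if `|f x| <= N%:R then f x else 0)|)
    @ \oo --> 0.
Proof.
move=> fi; have /integrableP[/measurable_EFinP mf _] := fi.
have := @dominated_cvg _ _ _ mu _ measurableT
  (fun N : nat => EFin \o (fun x => `|f x - (if `|f x| <= N%:R then f x else 0)|))
  (cst 0%E) (EFin \o (Num.norm \o f)).
rewrite integral0 => h; apply: (fine_cvg (h _ _ _ _ _)) => //.
- move=> N; apply/measurable_EFinP/measurableT_comp => //.
  apply: measurable_funB => //; apply: measurable_fun_ifT => //.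
  by apply: measurable_fun_ler => //; exact: measurableT_comp.
- move=> x _; apply: cvg_EFin; first exact: nearW.
  apply: (@cvg_near_cst _ _ _ _ _ _ ) => /=.
  exists (Num.truncn `|f x|).+1 => // N /= fN.
  rewrite ifT ?subrr ?normr0// (le_trans (ltW (truncnS_gt _)))//.
  by rewrite ler_nat.
- exact: integrable_norm.
- move=> N x _ /=; rewrite lee_fin normr_id.
  by case: ifPn => _; rewrite ?subrr ?normr0 ?subr0.
Qed.

(* The truncations of F are bounded and converge to F in L^1, while the S n are
   bounded in L^oo. *)
Lemma bounded_weak_cvg0_L1 (S : nat -> T -> R) (C : R) :
  (mu setT < +oo)%E -> (forall n, measurable_fun setT (S n)) ->
  (forall n x, `|S n x| <= C) ->
  (forall (h : T -> R) (N : R), measurable_fun setT h ->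
    (forall x, `|h x| <= N) ->
    (fun n => \int[mu]_x (h x * S n x)) @ \oo --> 0) ->
  forall F : T -> R, mu.-integrable setT (EFin \o F) ->
    (fun n => \int[mu]_x (F x * S n x)) @ \oo --> 0.
Proof.
move=> muT mS SC Sh F Fi; have /integrableP[/measurable_EFinP mF _] := Fi.
pose h (N : nat) x := if `|F x| <= N%:R then F x else 0.
have mh N : measurable_fun setT (h N).
  apply: measurable_fun_ifT => //.
  by apply: measurable_fun_ler => //; exact: measurableT_comp.
have hN N x : `|h N x| <= N%:R by rewrite /h; case: ifPn => //; rewrite normr0.
have ih N := integrable_bounded muT (mh N) (hN N).
have iFh N : mu.-integrable setT (EFin \o (fun x => F x - h N x)).
  exact: (integrableB measurableT Fi (ih N)).
apply/cvgrPdist_le => e e0.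
(* |C| + 1 is a bound for |S n| that is positive whatever [C] is, so the L^1 error of the truncation
   may be asked to be [e / 2] divided by it. *)
have C1 : 0 < `|C| + 1 by rewrite ltr_wpDl.
have [N _ HN] : \forall N \near \oo,
    \int[mu]_x `|F x - h N x| <= e / 2 / (`|C| + 1).
  have /cvgrPdist_le/(_ (e / 2 / (`|C| + 1))) := truncation_cvg_L1 Fi.
  rewrite !divr_gt0// => /(_ isT); apply: filterS => N.
  by rewrite sub0r normrN; exact/le_trans/ler_norm.
have {}HN := HN N (leqnn N).
have /cvgrPdist_le/(_ (e / 2)) := Sh (h N) N%:R (mh N) (hN N).
rewrite divr_gt0// => /(_ isT); apply: filterS => n; rewrite !sub0r !normrN => hS.
have iFS := integrable_mul_bounded (iFh N) (mS n) (SC n).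
have ihS := integrable_mul_bounded (ih N) (mS n) (SC n).
(* [N] is now fixed: the first integral is at most [e / 2] for every [n], the second one for large
   [n]. *)
have -> : \int[mu]_x (F x * S n x) =
    \int[mu]_x ((F x - h N x) * S n x) + \int[mu]_x (h N x * S n x).
  by rewrite -RintegralD//; apply: eq_Rintegral => x _; rewrite -mulrDl subrK.
rewrite (splitr e) (le_trans (ler_normD _ _))// lerD//.
rewrite (le_trans (le_normr_Rintegral _ iFS))//.
have -> : e / 2 = (e / 2 / (`|C| + 1)) * (`|C| + 1) by rewrite divfK ?gt_eqF.
apply: (@le_trans _ _ (\int[mu]_x `|F x - h N x| * (`|C| + 1))); last first.
  by rewrite ler_wpM2r// ltW.
have iFn := integrable_norm (iFh N).
rewrite -RintegralZr//; apply: le_Rintegral => //.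
- exact: integrable_norm iFS.
- apply: (@integrable_mul_bounded _ _ (`|C| + 1)) => // x.
  by rewrite ger0_norm// ltW.
- move=> x _; rewrite normrM ler_wpM2l// (le_trans (SC n x))//.
  by rewrite (le_trans (ler_norm _))// lerDl.
Qed.

End RealIntegrals.

(** * Cesaro means of uniformly bounded families *)

Lemma Rintegral_mean d (T : measurableType d) (R : realType)
    (mu : {measure set T -> \bar R}) (F : T -> R) (f : nat -> T -> R) (C : R) :
  mu.-integrable setT (EFin \o F) -> (forall j, measurable_fun setT (f j)) ->
  (forall j x, `|f j x| <= C) -> forall n : nat,
  n%:R^-1 * \sum_(j < n) \int[mu]_x (F x * f j x) =
  \int[mu]_x (F x * (n%:R^-1 * \sum_(j < n) f j x)).
Proof.
move=> iF mf fC n.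
have iFf j := integrable_mul_bounded iF (mf j) (fC j).
rewrite -Rintegral_sum; last by move=> i; exact: iFf.
rewrite -RintegralZl//; last by apply: integrable_big => i; exact: iFf.
by apply: eq_Rintegral => x _; rewrite -mulr_sumr mulrCA.
Qed.

Lemma mean_bounded (R : realType) (a : nat -> R) (C : R) :
  0 <= C -> (forall j, `|a j| <= C) ->
  forall n : nat, `|n%:R^-1 * \sum_(j < n) a j| <= C.
Proof.
(* The empty mean is 0 since [0^-1 = 0]; its bound is [0 <= C]. *)
move=> C0 aC [|n]; first by rewrite invr0 mul0r normr0.
rewrite normrM ger0_norm ?invr_ge0// ler_pdivrMl//.
rewrite (le_trans (ler_norm_sum _ _ _))// mulr_natl.
by rewrite -[X in C *+ X](card_ord n.+1) -sumr_const; apply: ler_sum.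
Qed.

(** * Means of e_j (x) e_j on the product space *)

Section TensorMeans.
Context d (T : measurableType d) (R : realType).
Variable mu : {finite_measure set T -> \bar R}.

Lemma product_measure_lty : ((mu \x mu)%E setT < +oo)%E.
Proof.
rewrite -setXTT product_measure1E//.
by rewrite ltey_eq fin_numM// fin_num_measure.
Qed.

Lemma measurable_tensor (f g : T -> R) :
  measurable_fun setT f -> measurable_fun setT g ->
  measurable_fun setT (fun z : T * T => f z.1 * g z.2).
Proof.
by move=> mf mg; apply: measurable_funM; exact: measurableT_comp.
Qed.

(** Fubini's theorem; boundedness and finiteness of the measure give the integrability. *)
Lemma Rintegral_tensor (f g : T -> R) (C D : R) :
  measurable_fun setT f -> measurable_fun setT g ->
  (forall x, `|f x| <= C) -> (forall x, `|g x| <= D) ->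
  \int[(mu \x mu)%E]_z (f z.1 * g z.2) =
  (\int[mu]_x f x) * (\int[mu]_x g x).
Proof.
move=> mf mg fC gD.
have muT : (mu setT < +oo)%E by rewrite ltey_eq fin_num_measure.
have fi := integrable_bounded muT mf fC.
have gi := integrable_bounded muT mg gD.
have fgi : (mu \x mu)%E.-integrable setT (EFin \o (fun z : T * T => f z.1 * g z.2)).
  apply: (@integrable_bounded _ _ _ _ _ (C * D)) => [||z].
  - exact: product_measure_lty.
  - exact: measurable_tensor.
  - by rewrite normrM ler_pM.
rewrite {1}/Rintegral -(integral12_prod_meas1 fgi) /fubini_F/=.
rewrite -RintegralZr// /Rintegral; congr fine; apply: eq_integral => x _.
rewrite EFinM fineK; last exact: integrable_fin_num.
by rewrite -integralZl//; apply: eq_integral => y _; rewrite EFinM.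
Qed.

Variables (e : nat -> T -> R) (M : R).
Hypothesis me : forall n, measurable_fun setT (e n).
Hypothesis eM : forall n x, `|e n x| <= M.

(** For an orthonormal family, this is 1/n times the integral kernel of the orthogonal projection
    onto the span of the first [n] functions. *)
Definition tensor_mean (n : nat) (z : T * T) : R :=
  n%:R^-1 * \sum_(j < n) (e j z.1 * e j z.2).

Lemma measurable_tensor_mean n : measurable_fun setT (tensor_mean n).
Proof.
apply: measurable_funM => //; apply: measurable_sum => j.
exact: measurable_tensor.
Qed.

Lemma tensor_bounded j (z : T * T) : `|e j z.1 * e j z.2| <= M * M.
Proof. by rewrite normrM ler_pM. Qed.

Lemma tensor_mean_bounded n z : `|tensor_mean n z| <= M * M.
Proof.
apply: (@mean_bounded _ (fun j => e j z.1 * e j z.2)) => [|j].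
  exact: le_trans (normr_ge0 _) (tensor_bounded 0 z).
exact: tensor_bounded.
Qed.

Hypothesis orth : forall m n, \int[mu]_t (e m t * e n t) = (m == n)%:R.

(** Expanding the square and applying Fubini to each term gives n^-2 times the sum over i, j of the
    squared integral of e_i e_j. Only the [n] diagonal terms survive, each equal to 1. *)
Lemma Rintegral_tensor_mean_sqr n :
  \int[(mu \x mu)%E]_z (tensor_mean n z ^+ 2) = n%:R^-1.
Proof.
pose p i j t := e i t * e j t.
have mp i j : measurable_fun setT (p i j) by exact: measurable_funM.
have pM i j x : `|p i j x| <= M * M by rewrite normrM ler_pM.
have pi i j : (mu \x mu)%E.-integrable setT
    (EFin \o (fun z : T * T => p i j z.1 * p i j z.2)).
  apply: (@integrable_bounded _ _ _ _ _ ((M * M) * (M * M))) => [||z].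
  - exact: product_measure_lty.
  - exact: measurable_tensor.
  - by rewrite normrM ler_pM.
transitivity (\int[(mu \x mu)%E]_z (n%:R^-1 ^+ 2 *
    (\sum_(i < n) \sum_(j < n) p i j z.1 * p i j z.2))).
  apply: eq_Rintegral => z _; rewrite exprMn; congr (_ * _).
  rewrite expr2 big_distrlr/=; apply: eq_bigr => i _; apply: eq_bigr => j _.
  by rewrite /p mulrACA.
rewrite RintegralZl//; last first.
  by apply: integrable_big => i; apply: integrable_big => j.
rewrite Rintegral_sum; last by move=> i; apply: integrable_big => j.
transitivity (n%:R^-1 ^+ 2 * \sum_(i < n) (1 : R)).
  congr (_ * _); apply: eq_bigr => i _; rewrite Rintegral_sum//.
  rewrite (bigD1 i)//= big1 ?addr0 => [|j ji].
    rewrite (@Rintegral_tensor _ _ (M * M) (M * M))// /p orth.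
    by rewrite eqxx mulr1.
  rewrite (@Rintegral_tensor _ _ (M * M) (M * M))// /p orth.
  by rewrite eq_sym val_eqE (negPf ji) mulr0.
(* For [n = 0] both sides are 0, by the convention [0^-1 = 0]. *)
rewrite sumr_const card_ord; case: n => [|n]; first by rewrite mulr0n mulr0 invr0.
by rewrite expr2 -mulrA mulVf ?mulr1// pnatr_eq0.
Qed.

(* AM-GM: [|h| <= N] gives [|h S| <= N (l + S^2 / l)] for every [l > 0], and the
   integral of [S^2] is [1/n]. *)
Lemma tensor_mean_bounded_weak_cvg0 (h : T * T -> R) (N : R) :
  measurable_fun setT h -> (forall z, `|h z| <= N) ->
  (fun n => \int[(mu \x mu)%E]_z (h z * tensor_mean n z)) @ \oo --> 0.
Proof.
move=> mh hN; apply/cvgrPdist_le => eps eps0.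
pose V := fine ((mu \x mu)%E setT).
have V0 : 0 <= V by rewrite fine_ge0.
have N1 : 0 < `|N| + 1 by rewrite ltr_wpDl.
have V1 : 0 < V + 1 by rewrite ltr_wpDl.
(* With |N| + 1 as bound for |h|, this [l] makes the constant term (|N| + 1) l V at most [eps / 2],
   [V] being the total mass. Adding 1 keeps both divisors positive. *)
pose l := eps / 2 / (`|N| + 1) / (V + 1).
have l0 : 0 < l by rewrite !divr_gt0.
have cn : (fun n : nat => (`|N| + 1) / l * n%:R^-1) @ \oo --> 0.
  rewrite -(mulr0 ((`|N| + 1) / l)); apply: cvgMl_tmp.
  (* The harmonic sequence is 1/(n+1), hence the shift. *)
  by rewrite -cvg_shiftS; exact: cvg_harmonic.
have /cvgrPdist_le/(_ (eps / 2)) := cn.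
rewrite divr_gt0// => /(_ isT); apply: filterS => n; rewrite !sub0r !normrN => hn.
have mS := measurable_tensor_mean n.
have bS := tensor_mean_bounded n.
have iS2 : (mu \x mu)%E.-integrable setT (EFin \o (fun z => tensor_mean n z ^+ 2)).
  apply: (@integrable_bounded _ _ _ _ _ ((M * M) ^+ 2)) => [||z].
  - exact: product_measure_lty.
  - exact: measurable_funX.
  - by rewrite normrX lerXn2r// nnegrE// (le_trans (normr_ge0 _) (bS z)).
have ihS : (mu \x mu)%E.-integrable setT (EFin \o (fun z => h z * tensor_mean n z)).
  apply: integrable_mul_bounded mS bS.
  exact: integrable_bounded product_measure_lty mh hN.
have ic (c : R) : (mu \x mu)%E.-integrable setT (EFin \o (fun _ => c)).
  exact: (@integrable_bounded _ _ _ _ _ `|c|) product_measure_lty _ _.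
have iS2l : (mu \x mu)%E.-integrable setT
    (EFin \o (fun z => (`|N| + 1) / l * tensor_mean n z ^+ 2)) :=
  integrableZl measurableT ((`|N| + 1) / l) iS2.
rewrite (le_trans (le_normr_Rintegral _ ihS))//.
apply: (@le_trans _ _ (\int[(mu \x mu)%E]_z
    ((`|N| + 1) * l + (`|N| + 1) / l * tensor_mean n z ^+ 2))).
  apply: le_Rintegral => //.
  - exact: integrable_norm.
  - exact: (integrableD measurableT (ic _) iS2l).
  - move=> z _; rewrite normrM.
    have hS : `|tensor_mean n z| <= l + l^-1 * tensor_mean n z ^+ 2.
      (* Multiplied by [l], the claim reads l s <= l^2 + s^2 with s the absolute value of the
         mean. *)
      rewrite -(ler_pM2l l0) mulrDr (mulVKf (lt0r_neq0 l0)).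
      rewrite -(@real_normK _ (tensor_mean n z)) ?num_real//.
      move: `|tensor_mean n z| (normr_ge0 (tensor_mean n z)) => s s0; nra.
    rewrite -(mulrA _ l^-1) -mulrDr ler_pM//.
    by rewrite (le_trans (hN z))// (le_trans (ler_norm _))// lerDl.
rewrite RintegralD//.
rewrite Rintegral_cst// RintegralZl// Rintegral_tensor_mean_sqr.
rewrite (splitr eps) lerD//; last exact: le_trans (ler_norm _) hn.
rewrite -/V /l (_ : _ * _ * V = eps / 2 * (V / (V + 1))); last first.
  by rewrite mulrA (mulrC (`|N| + 1)) divfK ?gt_eqF// mulrAC mulrA.
by rewrite ler_piMr ?(ltW (divr_gt0 eps0 _))// ler_pdivrMr// mul1r lerDl.
Qed.

(** The kernels QV are only L^1, so the bounded case is extended by truncation. *)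
Lemma tensor_mean_weak_cvg0 (F : T * T -> R) :
  (mu \x mu)%E.-integrable setT (EFin \o F) ->
  (fun n => \int[(mu \x mu)%E]_z (F z * tensor_mean n z)) @ \oo --> 0.
Proof.
apply: bounded_weak_cvg0_L1.
- exact: product_measure_lty.
- exact: measurable_tensor_mean.
- exact: tensor_mean_bounded.
- exact: tensor_mean_bounded_weak_cvg0.
Qed.

End TensorMeans.

(** * Means of e_j^2 on the unit interval *)

Section UnitIntervalMeans.
Context (R : realType).
Local Notation mu := (@mu01 R).

Lemma bounded_Lfun_oo (h : R -> R) (N : R) :
  measurable_fun setT h -> (forall t, `|h t| <= N) -> h \in Lfun mu +oo.
Proof.
move=> mh hN; rewrite inE; apply/andP; split; rewrite inE//=.
rewrite /finite_norm unlock /Lnorm; case: ifPn => // _.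
apply: (@le_lt_trans _ _ N%:E); last by rewrite ltry.
by apply/ess_supP; apply: nearW => t /=; rewrite lee_fin.
Qed.

(** With [S n] the mean of the squares minus 1, weak uniform density is weak convergence of [S n] to
    0 against bounded functions. As |S n| <= M^2 + 1, truncation extends it to [F], and the integral
    of [F] is added back. *)
Lemma weakly_uniformly_dense_L1 (e : nat -> R -> R) (M : R) :
  (forall n, measurable_fun setT (e n)) -> (forall n t, `|e n t| <= M) ->
  weakly_uniformly_dense e ->
  forall F : R -> R, mu.-integrable setT (EFin \o F) ->
  (fun n : nat => n%:R^-1 * \sum_(j < n) \int[mu]_t (F t * e j t ^+ 2))
    @ \oo --> \int[mu]_t F t.
Proof.
move=> me eM dense F iF.
have M0 : 0 <= M by exact: le_trans (normr_ge0 _) (eM 0 0).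
have me2 j : measurable_fun setT (fun t => e j t ^+ 2) by exact: measurable_funX.
have eM2 j t : `|e j t ^+ 2| <= M ^+ 2 by rewrite normrX lerXn2r ?nnegrE.
pose mean (n : nat) t := n%:R^-1 * \sum_(j < n) e j t ^+ 2.
have mmean n : measurable_fun setT (mean n).
  by apply: measurable_funM => //; exact: measurable_sum.
have meanM n t : `|mean n t| <= M ^+ 2.
  by apply: (@mean_bounded _ (fun j => e j t ^+ 2)) => //; exact: sqr_ge0.
have mu_fin : (mu setT < +oo)%E by rewrite mu01T ltry.
have cvg0 : (fun n => \int[mu]_t (F t * (mean n t - 1))) @ \oo --> 0.
  apply: (@bounded_weak_cvg0_L1 _ _ _ mu _ (M ^+ 2 + 1)) => //.
  - by move=> n; apply: measurable_funB => //; exact: mmean.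
  - by move=> n t; rewrite (le_trans (ler_normB _ _))// normr1 lerD2r.
  - by move=> h N mh hN; apply: dense; exact: bounded_Lfun_oo hN.
rewrite -[X in _ --> X]add0r.
apply: cvg_trans (cvgD cvg0 (cvg_cst _)); apply: near_eq_cvg; apply: nearW => n.
rewrite (Rintegral_mean iF me2 eM2) -/(mean n).
rewrite fctE -RintegralD//.
  by apply: eq_Rintegral => t _; rewrite mulrBr mulr1 subrK.
apply: (@integrable_mul_bounded _ _ _ _ _ _ (M ^+ 2 + 1)) => //.
  by apply: measurable_funB => //; exact: mmean.
by move=> t; rewrite (le_trans (ler_normB _ _))// normr1 lerD2r.
Qed.

(** [dot] is a chosen version of the derivative, so even for the zero function it is known only up
    to a null set. *)
Lemma ae_derivative0_dot : {ae mu, forall t, dot (0 : R -> R) t = 0}.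
Proof.
have d0 : ae_derivative (0 : R -> R) 0 by apply: nearW => t; exact: is_derive_cst.
have [_ d1] := dotP (measurable_cst (0 : R)) d0.
exact: ae_derivative_unique d1 d0.
Qed.

End UnitIntervalMeans.

(** * The inverse metric *)

Section MetricInverse.
Context (R : realType) (d : nat).

(** The matrix is diagonal with entries 1 or -1, so it squares to the identity. *)
Lemma invmx_metric (g : metric) : invmx (metric_mx R d g) = metric_mx R d g.
Proof.
have gg : metric_mx R d g *m metric_mx R d g = 1%:M.
  rewrite mulmx_diag -diag_const_mx; congr diag_mx; apply/rowP => i; rewrite !mxE.
  by case: (i == 0); case: g => /=; rewrite ?mulr1// mulrNN mulr1.
have [gu _] := mulmx1_unit gg.
by rewrite -[LHS]mulmx1 -gg mulKmx.
Qed.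

End MetricInverse.

(** * The integral form on elementary tensors and its Cesaro limit *)

Section QuadraticForm.
Context (R : realType) (k : path_kind) (d : nat).
Local Notation E := (Espace R k d.+1).
Local Notation bilE := (clin E (clin E R^o)).
Local Notation mu := (@mu01 R).
Context (P : 'M[R]_d.+1).
Hypothesis PP : orthonormal_rows P.

(** By orthonormality, [row m P *m P^T] is row [m] of the identity. *)
Lemma coordinate_tens (e : E1space R k) (m n : 'I_d.+1) :
  coordinate P (tens (row m P) e) n = if n == m then e1_fun e else 0.
Proof.
apply/funext => t; rewrite /coordinate /=.
rewrite -scalemxAl -row_mul PP !mxE eq_sym.
by case: eqP => _; rewrite ?mulr1 ?mulr0.
Qed.

Variables (Q : bilE) (QV : 'I_d.+1 -> 'I_d.+1 -> R * R -> R).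
Variables (QL QS : 'I_d.+1 -> 'I_d.+1 -> R -> R).
Hypothesis QE : integral_form P Q QV QL QS.

(** The condition [e 1 = 0] puts the path in E_0, where the integral form is available. Only its
    coordinate [m] can be non-zero, which reduces the first two double sums to the entry (m, m). *)
Lemma quadratic_form_tens (e : E1space R k) (m : 'I_d.+1) : e 1 = 0 ->
  Q (tens (row m P) e) (tens (row m P) e) =
  \int[(mu \x mu)%E]_z (QV m m z * (e z.1 * e z.2)) +
  \int[mu]_t (QL m m t * e t ^+ 2).
Proof.
move=> e1; have [_ _ QSP ->]// := QE; last 2 first.
- by rewrite /= e1 scale0r.
- by rewrite /= e1 scale0r.
rewrite /= -[RHS]addr0; congr (_ + _ + _).
- apply: eq_Rintegral => z _.
  rewrite (bigD1 m)//= [X in _ + X]big1 => [|i im]; last first.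
    by apply: big1 => j _; rewrite coordinate_tens (negPf im) mulr0 mul0r.
  rewrite addr0 (bigD1 m)//= big1 => [|j jm].
    by rewrite addr0 !coordinate_tens eqxx mulrA.
  by rewrite [coordinate _ _ j]coordinate_tens (negPf jm) mulr0.
- apply: eq_Rintegral => t _.
  rewrite (bigD1 m)//= [X in _ + X]big1 => [|i im]; last first.
    by apply: big1 => j _; rewrite coordinate_tens (negPf im) mulr0 mul0r.
  rewrite addr0 (bigD1 m)//= big1 => [|j jm].
    by rewrite addr0 !coordinate_tens eqxx expr2 mulrA.
  by rewrite [coordinate _ _ j]coordinate_tens (negPf jm) mulr0.
(* The QS integrand vanishes only almost everywhere, so its measurability is established first. *)
have mE f : f \in E1_pred k -> measurable_fun setT f.
  by move/E1_Lfun; exact: Lfun_measurable.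
have mc i : measurable_fun setT (coordinate P (tens (row m P) e) i).
  by rewrite coordinate_tens; case: ifP => _; apply: mE; rewrite ?e1P ?rpred0.
have md i : measurable_fun setT (dot (coordinate P (tens (row m P) e) i)).
  suff : coordinate P (tens (row m P) e) i \in E1_pred k.
    by move/E1_dot => [_]; exact: Lfun_measurable.
  by rewrite coordinate_tens; case: ifP => _; rewrite ?e1P ?rpred0.
rewrite ae_eq0_Rintegral ?mulr0//.
  apply: measurable_sum => i; apply: measurable_sum => j; apply: measurable_funM.
    by have [/Lfun_measurable] := QSP i j.
  by apply: measurable_funD; apply: measurable_funM; [exact: md|exact: mc|exact: md|exact: mc].
have [_ QSmm] := QSP m m.
apply: filterS2 QSmm (ae_derivative0_dot R) => t QSt dot0.
apply: big1 => i _; apply: big1 => j _; rewrite !coordinate_tens.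
(* If i = j = m, antisymmetry gives [QS m m t = 0]. If only i = m, the undifferentiated factors are
   0. If i differs from m, the differentiated factors are [dot 0], which is 0 at this [t]. *)
case: (eqVneq i m) => [->|_]; case: (eqVneq j m) => [->|_] /=.
- by rewrite (_ : QS m m t = 0) ?mul0r//; lra.
- by rewrite (_ : (0 : R -> R) t = 0)// !mulr0 addr0 mulr0.
- by rewrite dot0 !mul0r addr0 mulr0.
- by rewrite dot0 !mul0r addr0 mulr0.
Qed.

Variable e : nat -> E1space R k.
Hypothesis ON : forall m n, \int[mu]_t (e m t * e n t) = (m == n)%:R.
Hypothesis dense : weakly_uniformly_dense (fun n => e n).
Hypothesis e1 : forall n, e n 1 = 0.
Hypothesis ub : uniformly_bounded (fun n => e n).

(** Sum of two limits: 0 from the QV term, the integral of [QL m m] from the QL term. *)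
Lemma mean_quadratic_form_cvg (m : 'I_d.+1) :
  (fun n : nat => n%:R^-1 * \sum_(j < n)
     Q (tens (row m P) (e j)) (tens (row m P) (e j))) @ \oo -->
  \int[mu]_t QL m m t.
Proof.
have [M eM01] := ub.
(* The bound is given on [0, 1] only. Outside, representatives are 0, and [M] is nonnegative because
   it bounds |e n 0|. *)
have eM n t : `|e n t| <= M.
  have [t01|t01] := boolP (t \in `[0, 1]); first exact: eM01.
  have : e1_fun (e n) \in E1_pred k by exact: e1P.
  rewrite inE => -[_ -> // _]; rewrite normr0.
  by apply: le_trans (normr_ge0 (e n 0)) (eM01 _ _ _); rewrite in_itv/= lexx ler01.
have me n : measurable_fun setT (e n).
  exact: Lfun_measurable (E1_Lfun (e1P (e n))).
have [QVP QLP _ _] := QE.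
have /Lfun1_integrable iV := QVP m m.
have [/Lfun1_integrable iL _] := QLP m m.
have cV := @tensor_mean_weak_cvg0 _ _ R mu (fun n => e n) M me eM ON _ iV.
have cL := weakly_uniformly_dense_L1 me eM dense iL.
rewrite -[X in _ --> X]add0r; apply: cvg_trans (cvgD cV cL).
apply: near_eq_cvg; apply: nearW => n; rewrite fctE.
rewrite /tensor_mean -(@Rintegral_mean _ _ _ (mu \x mu)%E (QV m m)
  (fun j (z : R * R) => e j z.1 * e j z.2) (M * M) iV).
- rewrite -mulrDr -big_split/=; congr (_ * _); apply: eq_bigr => j _.
  by rewrite (quadratic_form_tens m (e1 j)).
- by move=> j; exact: (measurable_tensor (me j) (me j)).
- by move=> j z; exact: (tensor_bounded eM).
Qed.

(** Puts the integral trace in the shape of the basis trace: one term for index 0, and the others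
    weighted by the sign of the metric. *)
Lemma Rintegral_metric_trace (g : metric) :
  \int[mu]_t (\sum_m \sum_n QL m n t * invmx (metric_mx R d g) m n) =
  \int[mu]_t QL ord0 ord0 t +
  metric_sign R g * \sum_(m | m != ord0) \int[mu]_t QL m m t.
Proof.
have [_ QLP _ _] := QE.
have iL m : mu.-integrable setT (EFin \o QL m m).
  by apply/Lfun1_integrable; have [] := QLP m m.
pose c (m : 'I_d.+1) : R := if m == 0 then 1 else metric_sign R g.
have iLc m : mu.-integrable setT (EFin \o (fun t => QL m m t * c m)).
  apply: (@integrable_mul_bounded _ _ _ _ _ _ `|c m|) => //.
transitivity (\int[mu]_t (\sum_m QL m m t * c m)).
  apply: eq_Rintegral => t _; apply: eq_bigr => m _.
  rewrite (bigD1 m)//= big1 => [|n nm]; rewrite invmx_metric !mxE ?eqxx ?addr0//.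
  by rewrite [m == n]eq_sym (negPf nm) mulr0n mulr0.
rewrite Rintegral_sum// (bigD1 ord0)//= RintegralZr// {1}/c eqxx mulr1.
congr (_ + _); rewrite mulr_sumr; apply: eq_bigr => m m0.
by rewrite RintegralZr// /c (negPf m0) mulrC.
Qed.

(** The finitely many limits, one per row of [P], are combined with the signs of the metric, after
    exchanging the sums over j and m. *)
Lemma basis_levy_trace_integral (g : metric) :
  basis_levy_trace P e g Q
    (\int[mu]_t (\sum_m \sum_n QL m n t * invmx (metric_mx R d g) m n)).
Proof.
rewrite Rintegral_metric_trace /basis_levy_trace /=.
pose a m (n : nat) : R := n%:R^-1 * \sum_(j < n)
  Q (tens (row m P) (e j)) (tens (row m P) (e j)).
have asum : (fun n => \sum_(m | m != ord0) a m n) @ \oo -->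
    \sum_(m | m != ord0) \int[mu]_t QL m m t.
  apply: cvg_big => [|m _]; first exact: add_continuous.
  exact: mean_quadratic_form_cvg.
have csum : (fun n => metric_sign R g * \sum_(m | m != ord0) a m n) @ \oo -->
    metric_sign R g * \sum_(m | m != ord0) \int[mu]_t QL m m t.
  exact: cvgMl_tmp.
have c0 : a ord0 @ \oo --> \int[mu]_t QL ord0 ord0 t.
  exact: mean_quadratic_form_cvg.
apply: cvg_trans (cvgD c0 csum).
apply: near_eq_cvg; apply: nearW => n; rewrite fctE.
rewrite big_split/= mulrDr; congr (_ + _).
by rewrite -mulr_sumr mulrCA exchange_big/= mulr_sumr.
Qed.

End QuadraticForm.

(** * Differential operators built from single-valued traces *)

Section DifferentialOperators.
Context (R : realType) (k : path_kind) (d : nat).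
Local Notation E := (Espace R k d.+1).
Local Notation dualE := (clin E R^o).
Local Notation bilE := (clin E dualE).

Lemma is_diff_unique (V W : normedModType R) (f : V -> W) (x : V) (A B : clin V W) :
  is_diff x f A -> is_diff x f B -> A = B.
Proof.
move=> fA fB; apply: val_inj; rewrite /=.
by rewrite -(@diff_val _ _ _ _ _ _ _ fA) (@diff_val _ _ _ _ _ _ _ fB).
Qed.

Section SingleValued.
Variables (S S' : bilE -> set R).
Hypothesis S'S : forall Q, S' Q `<=` S Q.
Hypothesis S_fun : forall Q, is_subset1 (S Q).

Lemma D2_subset1 f : is_subset1 (D2 S f).
Proof.
move=> F G [f1 [f2 [df1 df2 SF]]] [g1 [g2 [dg1 dg2 SG]]].
(* [f2] and [g2] differentiate [f1] and [g1], so these must agree as maps before the second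
   derivatives can be compared. *)
have fg1 : f1 = g1 by apply/funext => x; exact: is_diff_unique (df1 x) (dg1 x).
apply/funext => x; apply: S_fun (SF x) _.
rewrite (_ : f2 x = g2 x)//; apply: is_diff_unique (df2 x) _.
by rewrite fg1.
Qed.

Lemma D1_subset1 B : is_subset1 (D1 S B).
Proof.
move=> F G [B1 [dB1 SF]] [C1 [dC1 SG]].
apply/funext => x; apply: S_fun (SF x) _.
by rewrite (is_diff_unique (dB1 x) (dC1 x)).
Qed.

(** A nonempty subset of a set with at most one element equals that set. *)
Lemma same_value_subset (X Y : Type) (A A' : X -> set Y) x :
  A' x `<=` A x -> is_subset1 (A x) -> dom A' x -> same_value A A' x.
Proof.
move=> A'A A1 [y A'y]; exists y.
split; apply/seteqP; split=> [z Az|_ ->] //=.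
- exact: A1 (A'A _ _).
- exact: A'A.
- exact: A1 (A'A _ _) (A'A _ _).
Qed.

(** Meant for [S'] the integral trace and [S] the basis trace: the same derivatives witness both
    operators, and single-valuedness is needed for [S] alone. *)
Lemma D2_same_value f : dom (D2 S') f -> same_value (D2 S) (D2 S') f.
Proof.
apply: same_value_subset; last exact: D2_subset1.
move=> F [f1 [f2 [df1 df2 SF]]]; exists f1, f2; split => // x.
exact: S'S.
Qed.

Lemma D1_same_value B : dom (D1 S') B -> same_value (D1 S) (D1 S') B.
Proof.
apply: same_value_subset; last exact: D1_subset1.
by move=> F [B1 [dB1 SF]]; exists B1; split => // x; exact: S'S.
Qed.

End SingleValued.

Lemma dom_D2 (S S' : bilE -> set R) f :
  (forall Q, dom S Q -> dom S' Q) -> dom (D2 S) f -> dom (D2 S') f.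
Proof.
move=> SS' [F [f1 [f2 [df1 df2 SF]]]].
(* A value of [S'] is chosen at each point to form the function [G]. *)
have [G SG] := choice (fun x => SS' (f2 x) (ex_intro _ (F x) (SF x))).
by exists G, f1, f2.
Qed.

End DifferentialOperators.

(** * Comparison of the two traces and of their operators *)

Section LevyTraceComparison.
Context (R : realType) (k : path_kind) (d : nat).
Context (P : 'M[R]_d.+1) (e : nat -> E1space R k).

Lemma basis_levy_trace_subset1 g Q : is_subset1 (basis_levy_trace P e g Q).
Proof. exact: cvg_unique. Qed.

(** The metric enters the value of the trace but not the condition on the kernels, so the same
    kernels serve [g']. *)
Lemma dom_integral_levy_trace g g' (Q : clin (Espace R k d.+1) (clin (Espace R k d.+1) R^o)) :
  dom (integral_levy_trace P g) Q -> dom (integral_levy_trace P g') Q.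
Proof.
move=> [_ [QV [QL [QS [QE _]]]]].
by exists (\int[@mu01 R]_t (\sum_m \sum_n QL m n t * invmx (metric_mx R d g') m n)), QV, QL, QS.
Qed.

Lemma integral_levy_trace_sub_basis :
  orthonormal_rows P ->
  L2_orthonormal_basis (fun n => e n) ->
  weakly_uniformly_dense (fun n => e n) ->
  (forall n, e n 1 = 0) ->
  uniformly_bounded (fun n => e n) ->
  forall g Q, integral_levy_trace P g Q `<=` basis_levy_trace P e g Q.
Proof.
move=> PP [_ ON _] dense e1 ub g Q _ [QV [QL [QS [QE ->]]]].
exact: (basis_levy_trace_integral PP QE ON dense e1 ub).
Qed.

End LevyTraceComparison.

Theorem theorem2 (R : realType) (d : nat) (k : path_kind)
    (P : 'M[R]_d.+1) (e : nat -> E1space R k) :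
  orthonormal_rows P ->
  L2_orthonormal_basis (fun n => e n) ->
  weakly_uniformly_dense (fun n => e n) ->
  (forall n, e n 1 = 0) ->
  uniformly_bounded (fun n => e n) ->
  (forall f : Espace R k d.+1 -> R^o,
     dom (levy_laplacian P) f ->
     same_value (basis_levy_laplacian P e) (levy_laplacian P) f /\
     same_value (basis_levy_dalembertian P e) (levy_dalembertian P) f) /\
  (forall (g : metric) (B : Espace R k d.+1 -> clin (Espace R k d.+1) R^o),
     dom (levy_divergence P g) B ->
     same_value (basis_levy_divergence P e g) (levy_divergence P g) B).
Proof.
move=> PP ON dense e1 ub.
have sub := integral_levy_trace_sub_basis PP ON dense e1 ub.
have sub1 := @basis_levy_trace_subset1 R k d P e.
split=> [f fd|g B Bd]; last exact: D1_same_value Bd.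
split; first exact: D2_same_value fd.
(* [f] is given in the domain of the Laplacian; it lies in that of the d'Alembertian because the two
   integral traces share their domain. *)
apply: D2_same_value => //.
by apply: dom_D2 fd => Q; exact: dom_integral_levy_trace.
Qed.
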